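(* Let $\varphi\in C^{\infty}(\mathbb{R})$ be an even function such that $\varphi''(\sigma)>0$ for every $\sigma\in[0,1)$, $\varphi''(1)=0$, and $\varphi''(\sigma)<0$ for every $\sigma>1$. Let $x_{1}\leq x_{3}<x_{4}\leq x_{2}$ and $T>0$ be real numbers. Let $u\in C^{1}\left((x_{1},x_{2})\times[0,T)\right)$ be a function satisfying $$u_{t}=\left(\varphi'(u_{x})\right)_{x}\quad\text{in }(x_{1},x_{2})\times[0,T),$$ and such that $$|u_{x}(x,0)|<1\quad\quad\forall x\in(x_{3},x_{4}).$$ Then $|u_{x}(x,t)|<1$ for every $(x,t)\in(x_{3},x_{4})\times[0,T)$.
   Context: Subscripts $x,t$ denote partial derivatives (one-sided in $t$ at $t=0$). Since $u$ is only assumed to be of class $C^{1}$, the equation $u_{t}=(\varphi'(u_{x}))_{x}$ is understood in the following sense: for every $t$ the function $x\mapsto\varphi'(u_{x}(x,t))$ is differentiable, and its derivative at $x$ equals $u_{t}(x,t)$, for every $(x,t)\in(x_1,x_2)\times[0,T)$. *)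

(* Defs.v *)
From HB Require Import structures.
From mathcomp Require Import all_boot all_order all_algebra.
From mathcomp Require Import all_classical all_reals all_analysis.

Set Implicit Arguments.
Unset Strict Implicit.
Unset Printing Implicit Defensive.

Import Order.TTheory GRing.Theory Num.Theory.
Import numFieldNormedType.Exports.

Local Open Scope classical_set_scope.
Local Open Scope ring_scope.

Definition smooth (R : realType) (f : R -> R) : Prop :=
  forall (n : nat) (x : R), derivable f^`(n)%classic x 1.

Definition cylinder (R : realType) (x1 x2 T : R) : set (R * R) :=
  `]x1, x2[%classic `*` `[0, T[%classic.

Definition partial_x (R : realType) (u : R * R -> R) (p : R * R) : R :=
  (fun y : R => u (y, p.2))^`()%classic p.1.

(* The increments s stay in [0, T[: the limit is the usual derivative
   for 0 < t < T, and the right derivative at t = 0. *)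
Definition diff_quot_t (R : realType) (T : R) (u : R * R -> R) (p : R * R) :=
  (s - p.2)^-1 * (u (p.1, s) - u p) @[s --> within `[0, T[%classic (p.2)^'].

Definition partial_t (R : realType) (T : R) (u : R * R -> R) (p : R * R) : R :=
  lim (diff_quot_t T u p).

(* [u] is total; only its values on the cylinder matter. *)
Definition C1_cylinder (R : realType) (x1 x2 T : R) (u : R * R -> R) : Prop :=
  [/\ forall p, cylinder x1 x2 T p ->
        derivable (fun y : R => u (y, p.2)) p.1 1 /\ cvg (diff_quot_t T u p),
      {within cylinder x1 x2 T, continuous u},
      {within cylinder x1 x2 T, continuous (partial_x u)} &
      {within cylinder x1 x2 T, continuous (partial_t T u)}].

Definition solves (R : realType) (phi : R -> R) (x1 x2 T : R)
    (u : R * R -> R) : Prop :=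
  forall x t : R, cylinder x1 x2 T (x, t) ->
    is_derive x 1 (fun y : R => phi^`()%classic (partial_x u (y, t)))
      (partial_t T u (x, t)).

(* Main.v *)
Require Import Defs.
From mathcomp Require Import all_boot all_order all_algebra.
From mathcomp Require Import all_classical all_reals all_analysis.
From mathcomp Require Import ring lra.
Import Order.TTheory GRing.Theory Num.Theory.
Import numFieldNormedType.Exports.
Local Open Scope classical_set_scope.
Local Open Scope ring_scope.

Set Implicit Arguments.
Unset Strict Implicit.

(** Write [f] for the derivative of [phi], [p] for the slope [u_x] and [v = f p]
for the flux, so that [u_t = v_x].  On the slopes [s > 0] the function [f]
attains its maximum [f 1] exactly at [s = 1]: as long as slopes stay positive,
[p] can reach the value 1 only where the nonnegative deficit [f 1 - v]
vanishes.  Formally [v] solves [v_t = f'(p) v_xx], so the deficit solves a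
parabolic equation which degenerates where [p = 1], and a degenerate diffusion
cannot make a positive deficit vanish in finite time.  This is shown by
comparing the deficit with the barrier
[A exp(-k t) (r^2 - (x - xc)^2)^2 - eps] on an interval [[xc - r, xc + r]]
inside [(x3, x4)].  Where this barrier is convex in [x] it is a subsolution
because [f' >= 0] and it decreases in time; where it is concave it is bounded
below, and a large [k] absorbs the diffusion term.  No condition at the ends of
the interval is required, since the barrier is negative there while the deficit
is nonnegative whatever the size of the slope.

At the first contact of the deficit with the barrier there are two cases.  If
the common value is 0, then [v] attains its maximum at the contact point, hence
[v_x = 0] there, whereas the level set [{barrier = 0}] carries a nonzero slope
of the barrier.  If the common value is positive, then [0 < p < 1] at the
contact point, and the contact contradicts the equation for [v].

As [u] is only of class [C^1], that equation holds merely in the viscosity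
sense; this is [flux_viscosity_subsolution].  It is derived from a comparison
principle, [local_comparison], which uses [u] itself: if [G_x = B] is a strict
supersolution of the equation for the slope and [p > B] somewhere, then
[(u - G)(y, t) - (u - G)(x, t)] has a positive maximum over [x <= y]; at this
maximum [p = B] at both points, and the one-sided signs of [(v - f B)_x] at [x]
and [y] contradict the sign of the time derivative.  Only [u_t], [u_x] and
[v_x] enter the argument.

The bound [p > -1] follows by applying the result to [- u], as [f] is odd. *)

(** * One-sided derivative tests *)

Lemma mean_value (R : realType) (h dh : R -> R) (a b : R) : a < b ->
    (forall x, a <= x <= b -> is_derive x 1 h (dh x)) ->
  exists2 c, a < c < b & h b - h a = dh c * (b - a).
Proof.
move=> ab dhP.
have hc : {within `[a, b], continuous h}.
  apply: derivable_within_continuous => x; rewrite in_itv/= => xab.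
  by have [] := dhP x xab.
have [x|c + hE] := @MVT R h dh _ _ ab _ hc.
  by rewrite in_itv/= => /andP[ax xb]; apply: dhP; rewrite !ltW.
by rewrite in_itv/=; exists c.
Qed.

Lemma pos_derive_near (R : realType) (h : R -> R) (y d : R) :
    is_derive y 1 h d -> 0 < d ->
  \forall s \near y, (y < s -> h y < h s) /\ (s < y -> h s < h y).
Proof.
move=> [hd hdE] d0.
have hc : (fun k : R => k^-1 *: (h (k + y) - h y)) @ 0^' --> d.
  move: hd; rewrite /derivable -hdE /derive => hd.
  by under [in X in X --> _]eq_fun do rewrite -[X in h (X + y)]mulr1.
have : nbhs (0 : R) (fun k => k != 0 -> 0 < k^-1 *: (h (k + y) - h y)).
  exact: (@cvgr_gt _ _ _ _ _ _ hc _ d0).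
move=> /(@nbhs_ballP R R)[e /= e0 he].
near=> s.
have bs : ball (0 : R) e (s - y).
  rewrite /ball/= sub0r normrN; near: s.
  apply/(@nbhs_ballP R R); exists e => //= s.
  by rewrite /ball/= distrC.
have {he bs} := he _ bs; rewrite subr_eq0 subrK /GRing.scale/= => he.
split=> sy.
- have := he (negbT (gt_eqF sy)).
  by rewrite pmulr_rgt0 ?invr_gt0 ?subr_gt0.
- have := he (negbT (lt_eqF sy)).
  by rewrite nmulr_rgt0 ?invr_lt0 ?subr_lt0.
Unshelve. all: by end_near. Qed.

Lemma near_right_pick (R : realType) (P : R -> Prop) (y b : R) :
  y < b -> (\forall s \near y, P s) ->
  exists2 c, y < c < b & forall s, y <= s <= c -> P s.
Proof.
move=> yb /(@nbhs_ballP R R)[e /= e0 he].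
exists (Num.min ((y + b) / 2) (y + e / 2)).
  rewrite lt_min gt_min; apply/andP; split; first by apply/andP; split; lra.
  by apply/orP; left; lra.
move=> s /andP[ys]; rewrite le_min => /andP[_ se]; apply: he.
rewrite /ball/= distrC ger0_norm ?subr_ge0//; lra.
Qed.

Lemma near_left_pick (R : realType) (P : R -> Prop) (a y : R) :
  a < y -> (\forall s \near y, P s) ->
  exists2 c, a < c < y & forall s, c <= s <= y -> P s.
Proof.
move=> yb /(@nbhs_ballP R R)[e /= e0 he].
exists (Num.max ((y + a) / 2) (y - e / 2)).
  rewrite gt_max lt_max; apply/andP; split; last by apply/andP; split; lra.
  by apply/orP; left; lra.
move=> s /andP[]; rewrite ge_max => /andP[_ se] ys; apply: he.
rewrite /ball/= ger0_norm ?subr_ge0//; lra.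
Qed.

Lemma derive_ge0_left_max (R : realType) (h : R -> R) (a y d : R) :
  a < y -> is_derive y 1 h d -> (forall s, a < s < y -> h s <= h y) -> 0 <= d.
Proof.
move=> ay hd hm; rewrite leNgt; apply/negP => d0.
have /(pos_derive_near (is_deriveN hd)) : 0 < - d by rewrite oppr_gt0.
move=> /(near_left_pick ay)[c /andP[ac cy]] /(_ c) [|_ /(_ cy)].
  by rewrite lexx ltW.
by rewrite /= ltrN2 ltNge hm ?ac.
Qed.

Lemma derive_le0_right_max (R : realType) (h : R -> R) (y b d : R) :
  y < b -> is_derive y 1 h d -> (forall s, y < s < b -> h s <= h y) -> d <= 0.
Proof.
move=> yb hd hm; rewrite leNgt; apply/negP => d0.
have /(near_right_pick yb)[c /andP[yc cb]] := pos_derive_near hd d0.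
move=> /(_ c) [|/(_ yc) + _]; first by rewrite lexx ltW.
by rewrite ltNge hm ?yc.
Qed.

Lemma derive_eq0_local_min (R : realType) (h : R -> R) (y d : R) :
  is_derive y 1 h d -> (\forall s \near y, h y <= h s) -> d = 0.
Proof.
move=> hd hm; apply/eqP; rewrite eq_le !leNgt; apply/andP; split; apply/negP => d0.
- have y1 : y - 1 < y by lra.
  have [c /andP[_ cy] /(_ c)] := near_left_pick y1
    (filterI hm (pos_derive_near hd d0)).
  by rewrite lexx ltW// => /(_ isT)[hc [_ /(_ cy)]]; rewrite ltNge hc.
- have y1 : y < y + 1 by lra.
  have nd0 : 0 < - d by rewrite oppr_gt0.
  have [c /andP[yc _] /(_ c)] := near_right_pick y1
    (filterI hm (pos_derive_near (is_deriveN hd) nd0)).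
  rewrite lexx ltW// => /(_ isT)[hc [/(_ yc) /= + _]].
  by rewrite ltrN2 ltNge hc.
Qed.

(** The flux excess [W] has the sign of the slope excess [z = Z'], and both vanish
at the maximum point [y] of [Z].  If [W] increased through 0 there, [z] would be
positive to the right of [y] and [Z] would exceed its maximum.  This replaces
the second derivative test [Z'' <= 0]: only [W] is differentiable, not [z]. *)
Lemma critical_flux_le0 (R : realType) (Z z W : R -> R) (y b d : R) : y < b ->
    (forall s, y <= s < b -> is_derive s 1 Z (z s)) ->
    (forall s, y < s < b -> Z s <= Z y) ->
    (forall s, y < s < b -> 0 < W s -> 0 < z s) ->
    W y = 0 -> is_derive y 1 W d ->
  d <= 0.
Proof.
move=> yb Zd Zm Wz W0 Wd; rewrite leNgt; apply/negP => d0.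
have /(near_right_pick yb)[c /andP[yc cb] Wc] := pos_derive_near Wd d0.
have [s /andP[ys ycb]|s /andP[ys sc]] := @mean_value _ Z z _ _ yc.
  by apply: Zd; rewrite ys (le_lt_trans ycb).
have zs : 0 < z s.
  apply: Wz; first by rewrite ys (lt_trans sc).
  by have [|/(_ ys)] := Wc s; rewrite ?W0// !ltW.
have := Zm c; rewrite yc cb => /(_ isT) Zcy ZE.
have : 0 < Z c - Z y by rewrite ZE mulr_gt0// subr_gt0.
by rewrite subr_gt0 ltNge Zcy.
Qed.

Lemma derive_continuous (R : realType) (f f1 : R -> R) :
  (forall x : R, is_derive x 1 f (f1 x)) -> continuous f.
Proof.
move=> df x; apply: differentiable_continuous; apply/derivable1_diffP.
by have [] := df x.
Qed.

Lemma strict_convex_min (R : realType) (h h1 h2 : R -> R) (x0 d : R) :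
    (forall x, x0 - d <= x <= x0 + d -> is_derive x 1 h (h1 x)) ->
    (forall x, x0 - d <= x <= x0 + d -> is_derive x 1 h1 (h2 x)) ->
    (forall x, x0 - d <= x <= x0 + d -> 0 < h2 x) -> h1 x0 = 0 ->
  forall x, x0 - d <= x <= x0 + d -> x != x0 -> h x0 < h x.
Proof.
move=> dh dh1 h2gt0 h10 x /andP[dx xd]; rewrite neq_lt => /orP[xx|xx].
- have [w /andP[xw wx0]|w /andP[xw wx0] hE] := @mean_value _ h h1 _ _ xx.
    by apply: dh; apply/andP; split; lra.
  have [v /andP[wv vx0]|v /andP[wv vx0] h1E] := @mean_value _ h1 h2 _ _ wx0.
    by apply: dh1; apply/andP; split; lra.
  have h2v : 0 < h2 v by apply: h2gt0; apply/andP; split; lra.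
  have : 0 < h2 v * (x0 - w) by rewrite mulr_gt0// subr_gt0.
  rewrite -h1E h10 sub0r oppr_gt0 => h1w.
  by rewrite -subr_lt0 hE nmulr_rlt0// subr_gt0.
- have [w /andP[xw wx0]|w /andP[xw wx0] hE] := @mean_value _ h h1 _ _ xx.
    by apply: dh; apply/andP; split; lra.
  have [v /andP[wv vx0]|v /andP[wv vx0] h1E] := @mean_value _ h1 h2 _ _ xw.
    by apply: dh1; apply/andP; split; lra.
  have h2v : 0 < h2 v by apply: h2gt0; apply/andP; split; lra.
  have : 0 < h2 v * (w - x0) by rewrite mulr_gt0// subr_gt0.
  rewrite -h1E h10 subr0 => h1w.
  by rewrite -subr_gt0 hE mulr_gt0// subr_gt0.
Qed.

Lemma pos_derive_mono (R : realType) (f f1 : R -> R) (a b : R) :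
    (forall x : R, is_derive x 1 f (f1 x)) ->
    (forall s, a < s < b -> 0 < f1 s) ->
  {in `[a, b] &, {mono f : x y / x < y}}.
Proof.
move=> df f1gt0; apply: leW_mono_in; apply: le_mono_in => x y.
rewrite !in_itv/= => /andP[ax xb] /andP[ay yb] xy.
have [c /andP[xc cy] fE] := mean_value xy (fun z _ => df z).
rewrite -subr_gt0 fE mulr_gt0 ?subr_gt0// f1gt0//.
by rewrite (le_lt_trans ax xc) (lt_le_trans cy yb).
Qed.

(** * Continuity and extrema on boxes *)

(** Composition with the retraction of the plane onto a box turns a function that
is continuous relative to the cylinder into a globally continuous one. *)
Definition clamp (R : realType) (a b x : R) := Num.max a (Num.min x b).

Lemma clamp_bounds (R : realType) (a b x : R) : a <= b -> a <= clamp a b x <= b.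
Proof. by move=> ab; rewrite le_max lexx/= ge_max ab ge_min lexx orbT. Qed.

Lemma clamp_id (R : realType) (a b x : R) : a <= x <= b -> clamp a b x = x.
Proof. by move=> /andP[ax xb]; rewrite /clamp (min_idPl xb) (max_idPr ax). Qed.

Lemma continuous_clamp (R : realType) (a b : R) : continuous (clamp a b : R -> R).
Proof.
move=> x; apply: (@continuous_max _ _ (cst a) (id \min cst b)).
  exact: cst_continuous.
by apply: (@continuous_min _ _ id (cst b)); [exact: cvg_id|exact: cst_continuous].
Qed.

Lemma continuous_clamp2 (R : realType) (g : R * R -> R) (x1 x2 T a b s r : R) :
    {within cylinder x1 x2 T, continuous g} ->
    x1 < a -> a <= b -> b < x2 -> 0 <= s -> s <= r -> r < T ->
  continuous (fun z : R * R => g (clamp a b z.1, clamp s r z.2)).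
Proof.
move=> /subspace_continuousP gc x1a ab bx2 s0 sr rT z.
have cyl w : cylinder x1 x2 T (clamp a b w.1, clamp s r w.2).
  have /andP[? ?] := clamp_bounds w.1 ab; have /andP[? ?] := clamp_bounds w.2 sr.
  split; rewrite /= in_itv/=; apply/andP; split; lra.
have kc : (fun w : R * R => (clamp a b w.1, clamp s r w.2)) @ z -->
    (clamp a b z.1, clamp s r z.2).
  have c1 : clamp a b w.1 @[w --> z] --> clamp a b z.1.
    by apply: continuous_comp; [exact: cvg_fst|exact: continuous_clamp].
  have c2 : clamp s r w.2 @[w --> z] --> clamp s r z.2.
    by apply: continuous_comp; [exact: cvg_snd|exact: continuous_clamp].
  exact: cvg_pair c1 c2.
apply: cvg_trans (gc _ (cyl z)) => A /= gA.
have := kc _ gA.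
rewrite !nbhs_simpl/=; apply: filterS => w /=; apply; exact: cyl.
Qed.

Lemma compact_segment (R : realType) (r s : R) :
  compact [set x : R | r <= x <= s].
Proof.
by have := @segment_compact R r s; congr compact;
  apply/seteqP; split => x /=; rewrite in_itv.
Qed.

(** The closed constraint is encoded as the sign of a continuous function [g]; it
serves for the half square [x <= y], for the parabolic boundary of a box, and
for the set where the deficit lies below the barrier. *)
Lemma EVT_superlevel (R : realType) (X : topologicalType) (K : set X)
    (g h : X -> R) :
    compact K -> continuous g -> continuous h ->
    (exists2 k, K k & 0 <= g k) ->
  exists m, [/\ K m, 0 <= g m & forall z, K z -> 0 <= g z -> h z <= h m].
Proof.
move=> Kc gc hc [k Kk gk].
have Lc : compact (K `&` g @^-1` [set y | 0 <= y]).
  by apply: compact_closedI => //; apply: preimage_closed => //; exact: closed_ge.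
have [||m /set_mem[Km gm] hm] := compact_EVT_max _ Lc (f := h).
- by exists k.
- exact: continuous_subspaceT.
by exists m; split => // z Kz gz; apply: hm; exact/mem_set.
Qed.

Lemma near_box (R : realType) (A : R * R -> Prop) (x0 t0 : R) :
    (\forall w \near (x0, t0), A w) ->
  exists2 d, 0 < d & forall x t, x0 - d <= x <= x0 + d ->
    t0 - d <= t <= t0 + d -> A (x, t).
Proof.
move=> /(@nbhs_ballP R (R * R)%type)[e /= e0 he].
exists (e / 2) => [|x t /andP[? ?] /andP[? ?]]; first lra.
by apply: he; split; rewrite /ball/= ltr_norml; apply/andP; split; lra.
Qed.

Lemma near_slice (R : realType) (A : R * R -> Prop) (x0 t0 : R) :
  (\forall w \near (x0, t0), A w) -> \forall x \near x0, A (x, t0).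
Proof.
move=> /near_box[d d0 hd]; apply/(@nbhs_ballP R R); exists d => //= x.
rewrite /ball/= ltr_norml => /andP[? ?]; apply: hd; apply/andP; split; lra.
Qed.

Lemma near_box3 (R : realType) (A : R * R * R -> Prop) (x0 t0 y0 : R) :
    (\forall w \near (x0, t0, y0), A w) ->
  exists2 d, 0 < d & forall x t y, x0 - d <= x <= x0 + d ->
    t0 - d <= t <= t0 + d -> y0 - d <= y <= y0 + d -> A (x, t, y).
Proof.
move=> /(@nbhs_ballP R (R * R * R)%type)[e /= e0 he].
exists (e / 2) => [|x t y /andP[? ?] /andP[? ?] /andP[? ?]]; first lra.
by apply: he; split; [split|]; rewrite /ball/= ltr_norml; apply/andP; split; lra.
Qed.

(** * Gradient flows *)

(** Slope [p] and time derivative [q] are data tied to [u] by pointwise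
conditions inside the cylinder, so that the notion passes to [- u]
componentwise; [f] stands for the derivative of the energy density. *)
Definition gradient_flow (R : realType) (f : R -> R) (x1 x2 T : R)
    (u p q : R * R -> R) : Prop :=
  [/\ {within cylinder x1 x2 T, continuous u},
      {within cylinder x1 x2 T, continuous p},
      forall x t : R, cylinder x1 x2 T (x, t) ->
        is_derive x 1 (fun y : R => u (y, t)) (p (x, t)),
      forall x t : R, cylinder x1 x2 T (x, t) ->
        (s - t)^-1 * (u (x, s) - u (x, t)) @[s --> within `[0, T[%classic t^']
          --> q (x, t) &
      forall x t : R, cylinder x1 x2 T (x, t) ->
        is_derive x 1 (fun y : R => f (p (y, t))) (q (x, t))].

Lemma cylinderP (R : realType) (x1 x2 T x t : R) :
  x1 < x < x2 -> 0 <= t < T -> cylinder x1 x2 T (x, t).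
Proof. by move=> xx tt; split; rewrite /= in_itv. Qed.

(** The interval of comparison lies before [t], so the maximum may be attained at
the final time of a box. *)
Lemma time_derivative_at_max (R : realType) (f : R -> R) (x1 x2 T : R)
    (u p q : R * R -> R) (x y t s0 k : R) :
    gradient_flow f x1 x2 T u p q ->
    x1 < x < x2 -> x1 < y < x2 -> 0 <= s0 -> s0 < t -> t < T ->
    (forall s, s0 < s < t ->
       u (y, s) - u (x, s) - k * s <= u (y, t) - u (x, t) - k * t) ->
  k <= q (y, t) - q (x, t).
Proof.
move=> [_ _ _ ut _] xx yy s00 s0t tT um.
have t0T : 0 <= t < T by rewrite tT (le_trans s00 (ltW s0t)).
have uy := ut _ _ (cylinderP yy t0T); have ux := ut _ _ (cylinderP xx t0T).
rewrite leNgt; apply/negP => qk.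
have : nbhs t (fun s : R => s != t -> `[0, T[%classic s ->
    (s - t)^-1 * (u (y, s) - u (y, t)) - (s - t)^-1 * (u (x, s) - u (x, t)) < k).
  exact: (@cvgr_lt _ _ _ _ _ _ (cvgB uy ux) _ qk).
move=> /(@nbhs_ballP R R)[e /= e0 he].
pose s := Num.max ((s0 + t) / 2) (t - e / 2).
have [s0s st te] : [/\ s0 < s, s < t & t - e / 2 <= s].
  by split; rewrite /s ?lt_max ?gt_max ?le_max ?lexx ?orbT//; lra.
have /he : ball t e s by rewrite /ball/= ger0_norm; lra.
move=> /(_ (negbT (lt_eqF st))).
rewrite /= in_itv/= (lt_trans st tT) andbT (ltW (le_lt_trans s00 s0s)) => /(_ isT).
rewrite -mulrBr mulrC ltr_ndivrMr ?subr_lt0//.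
have := um s; rewrite s0s st => /(_ isT); lra.
Qed.

Lemma gradient_flow_C1 (R : realType) (phi : R -> R) (x1 x2 T : R)
    (u : R * R -> R) :
    C1_cylinder x1 x2 T u -> solves phi x1 x2 T u ->
  gradient_flow phi^`()%classic x1 x2 T u (partial_x u) (partial_t T u).
Proof.
move=> [ud uc pc _] us; split => // x t xt.
- have [dux _] := ud _ xt.
  by rewrite /partial_x derive1E; exact/derivableP.
- by have [_ dut] := ud _ xt; exact: dut.
Qed.

Lemma gradient_flowN (R : realType) (f : R -> R) (x1 x2 T : R)
    (u p q : R * R -> R) :
    (forall s : R, f (- s) = - f s) ->
    gradient_flow f x1 x2 T u p q ->
  gradient_flow f x1 x2 T (fun w => - u w) (fun w => - p w) (fun w => - q w).
Proof.
move=> fodd [uc pc ux ut vx]; split.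
- by move=> w; apply: cvgN; exact: uc.
- by move=> w; apply: cvgN; exact: pc.
- by move=> x t xt; have := ux _ _ xt => dux; exact: is_deriveN.
- move=> x t xt.
  have -> : (fun s => (s - t)^-1 * (- u (x, s) - - u (x, t))) =
      - (fun s => (s - t)^-1 * (u (x, s) - u (x, t))).
    by apply/funext => s; rewrite -opprD mulrN.
  exact: cvgN (ut _ _ xt).
- move=> x t xt; have dv := vx _ _ xt.
  have -> : (fun y => f (- p (y, t))) = (fun y => - f (p (y, t))).
    by apply/funext => y; rewrite fodd.
  exact: is_deriveN.
Qed.

Lemma derive1_even (R : realType) (phi : R -> R) (s : R) :
    (forall x : R, derivable phi x 1) -> (forall x, phi (- x) = phi x) ->
  phi^`()%classic (- s) = - phi^`()%classic s.
Proof.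
move=> dphi phi_even.
have dN : is_derive s 1 (-%R : R -> R) (-1 : R).
  exact: (is_deriveN (is_derive_id s (1 : R))).
have dd : is_derive (- s) 1 phi (phi^`()%classic (- s)).
  by rewrite derive1E; exact/derivableP.
have := @is_derive1_comp _ phi -%R s _ _ dd dN.
have -> : phi \o -%R = phi by apply/funext => x /=; rewrite phi_even.
move=> [_]; rewrite -derive1E => ->; rewrite mulrN1 opprK //.
Qed.

Lemma flow_slope_continuous (R : realType) (f : R -> R) (x1 x2 T : R)
    (u p q : R * R -> R) (x t : R) :
    gradient_flow f x1 x2 T u p q -> x1 < x < x2 -> 0 < t < T ->
  (\forall w \near (x, t), cylinder x1 x2 T w) /\ p @ (x, t) --> p (x, t).
Proof.
move=> [_ /subspace_continuousP pc _ _ _] /andP[x1x xx2] /andP[t0 tT].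
have nc : \forall w \near (x, t), cylinder x1 x2 T w.
  exists (`]x1, x2[%classic, `]0, T[%classic).
    by split; apply: near_in_itvoo; rewrite in_itv/= ?x1x ?t0.
  move=> [y s] [/=]; rewrite !in_itv/= => yx /andP[s0 sT]; apply: cylinderP => //.
  by rewrite ltW.
split=> //; apply: cvg_trans (pc _ (nbhs_singleton nc)) => A /= pA.
have pA' : nbhs (x, t) (fun w => cylinder x1 x2 T w -> A (p w)) := pA.
by apply: filterS2 nc pA' => w cw; apply.
Qed.

(** * Comparison of slopes and the equation of the flux *)

(** Let [B (x, t) = P x + c t] and let [G (x, t) = Q x + c t x] be its primitive in
[x].  The hypothesis on [D = (f B)_x] is the integrated form of the strict
supersolution inequality [B_t > (f B)_xx].  If [p > B] somewhere, then
[Z = u - G] strictly increases on some interval, and the largest increment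
[Z (y, t) - Z (x, t)] over [x <= y] is positive.  The conditions on the
parabolic boundary force [t > s0] and [a < x < y < b].  Hence [Z_x = p - B]
vanishes at [x] and [y], and [critical_flux_le0] gives
[q (y, t) - q (x, t) <= D y t - D x t < c (y - x)], whereas maximality in time
gives the opposite inequality. *)
Lemma local_comparison (R : realType) (f : R -> R) (J : interval R)
    (x1 x2 T : R) (u p q : R * R -> R) (a b s0 t0 : R)
    (Q P : R -> R) (c : R) (D : R -> R -> R) :
    gradient_flow f x1 x2 T u p q ->
    x1 < a -> b < x2 -> 0 <= s0 -> t0 < T ->
    {in J &, {mono f : x y / x < y}} ->
    (forall x : R, is_derive x 1 Q (P x)) ->
    (forall x t : R, a <= x <= b -> s0 <= t <= t0 ->
       p (x, t) \in J /\ P x + c * t \in J) ->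
    (forall x t : R, a <= x <= b -> s0 <= t <= t0 ->
       is_derive x 1 (fun y : R => f (P y + c * t)) (D x t)) ->
    (forall x y t, a <= x -> x < y -> y <= b -> s0 <= t <= t0 ->
       D y t - D x t < c * (y - x)) ->
    (forall t, s0 <= t <= t0 -> p (a, t) < P a + c * t) ->
    (forall t, s0 <= t <= t0 -> p (b, t) < P b + c * t) ->
    (forall x, a <= x <= b -> p (x, s0) <= P x + c * s0) ->
  forall x t, a <= x <= b -> s0 <= t <= t0 -> p (x, t) <= P x + c * t.
Proof.
move=> flow x1a bx2 s00 t0T fJ dQ pBJ dD Dc pa pb ps xi tau xiab taust.
rewrite leNgt; apply/negP => viol.
have [uc _ ux _ vx] := flow.
have ab : a <= b by case/andP: xiab => /le_trans; apply.
have st0 : s0 <= t0 by case/andP: taust => /le_trans; apply.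
pose Z x t := u (x, t) - Q x - c * t * x.
pose z x t := p (x, t) - (P x + c * t).
pose W x t := f (p (x, t)) - f (P x + c * t).
have box x t : a <= x <= b -> s0 <= t <= t0 -> cylinder x1 x2 T (x, t).
  by move=> /andP[ax xb] /andP[st tt]; apply: cylinderP; clear -x1a bx2 s00 t0T ax xb st tt; apply/andP; split; lra.
have dZ (x t : R) : a <= x <= b -> s0 <= t <= t0 ->
    is_derive x 1 (fun y : R => Z y t) (z x t).
  move=> xab tst; have dux := ux _ _ (box _ _ xab tst).
  have dQx := dQ x.
  by apply: is_derive_eq; rewrite /z /GRing.scale/=; ring.
have dW (x t : R) : a <= x <= b -> s0 <= t <= t0 ->
    is_derive x 1 (fun y : R => W y t) (q (x, t) - D x t).
  by move=> xab tst; apply: is_deriveB; [apply: vx; exact: box|exact: dD].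
have Wz x t : a <= x <= b -> s0 <= t <= t0 -> (0 < W x t) = (0 < z x t).
  by move=> xab tst; have [pJ BJ] := pBJ _ _ xab tst; rewrite !subr_gt0 fJ.
have Wz' x t : a <= x <= b -> s0 <= t <= t0 -> (W x t < 0) = (z x t < 0).
  by move=> xab tst; have [pJ BJ] := pBJ _ _ xab tst; rewrite !subr_lt0 fJ.
have W0 x t : z x t = 0 -> W x t = 0.
  by move=> /subr0_eq zx; rewrite /W zx subrr.
have viol0 : 0 < z xi tau by rewrite subr_gt0.
have xib : xi < b.
  have /andP[_] := xiab; rewrite le_eqVlt => /predU1P[xibE|//].
  by have := pb _ taust; rewrite -xibE ltNge (ltW viol).
have [eta /andP[xieta etab]] :=
  near_right_pick xib (pos_derive_near (dZ _ _ xiab taust) viol0).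
move=> /(_ eta) []; first by rewrite lexx ltW.
move=> /(_ xieta) Zxieta _.
pose U w := u (clamp a b w.1, clamp s0 t0 w.2).
have Uc : continuous U by apply: (continuous_clamp2 uc) => //; lra.
have Qc : continuous Q.
  by move=> x; apply: differentiable_continuous; apply/derivable1_diffP; have [] := dQ x.
pose F (w : R * R * R) := (U (w.1.2, w.2) - Q w.1.2 - c * w.2 * w.1.2)
                        - (U (w.1.1, w.2) - Q w.1.1 - c * w.2 * w.1.1).
have c11 : continuous (fun w : R * R * R => w.1.1).
  by move=> w; apply: continuous_comp; exact: cvg_fst.
have c12 : continuous (fun w : R * R * R => w.1.2).
  by move=> w; apply: continuous_comp; [exact: cvg_fst|exact: cvg_snd].
have c2 : continuous (fun w : R * R * R => w.2) by move=> w; exact: cvg_snd.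
have Fc : continuous F.
  have half (y : R * R * R -> R) : continuous y ->
      continuous (fun w => U (y w, w.2) - Q (y w) - c * w.2 * y w).
    move=> yc w; apply: cvgB; first apply: cvgB.
    - by apply: (continuous_comp (cvg_pair (yc w) (c2 w))); exact: Uc.
    - by apply: (continuous_comp (yc w)); exact: Qc.
    - by apply: cvgM; [apply: cvgM; [exact: cvg_cst|exact: c2]|exact: yc].
  by move=> w; apply: cvgB; exact: half.
have FE x y t : a <= x <= b -> a <= y <= b -> s0 <= t <= t0 ->
    F (x, y, t) = Z y t - Z x t.
  by move=> xab yab tst; rewrite /F /U /= !clamp_id.
have := EVT_superlevel (compact_setX
  (compact_setX (@compact_segment R a b) (@compact_segment R a b))
  (@compact_segment R s0 t0))
  (fun w => cvgB (c12 w) (c11 w)) Fc.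
case.
  exists (xi, eta, tau); rewrite /= ?subr_ge0 ?(ltW xieta)//; split => //; split => //=.
  by case/andP: xiab => axi _; rewrite (le_trans axi (ltW xieta)) ltW.
move=> [[x y] t] [] [[/= xab yab tst]]; rewrite subr_ge0 => xy Fm.
have etaab : a <= eta <= b.
  by case/andP: xiab => axi _; rewrite (le_trans axi (ltW xieta)) ltW.
have Zm x' y' t' : a <= x' <= b -> a <= y' <= b -> s0 <= t' <= t0 -> x' <= y' ->
    Z y' t' - Z x' t' <= Z y t - Z x t.
  move=> ? ? ? x'y'; rewrite -!FE//; apply: Fm; first by split.
  by rewrite subr_ge0.
have Zpos : 0 < Z y t - Z x t.
  have := Zm xi eta tau xiab etaab taust (ltW xieta).
  by apply: lt_le_trans; rewrite subr_gt0.
(* The maximum is positive: this excludes the diagonal and the initial time. *)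
have {xy}xy : x < y.
  rewrite lt_neqAle xy andbT; apply/eqP => xyE.
  by move: Zpos; rewrite xyE subrr ltxx.
have [/andP[ax xb] /andP[ay yb]] := conj xab yab.
have /andP[st tt0] := tst.
have {st}st : s0 < t.
  rewrite lt_neqAle st andbT; apply/eqP => stE.
  have [w /andP[xw wy]|w /andP[xw wy] ZE] := @mean_value _ (Z^~ t) (z^~ t) _ _ xy.
    by apply: dZ => //; rewrite (le_trans ax xw) (le_trans wy).
  have : z w t <= 0.
    by rewrite subr_le0 -stE ps// (le_trans ax (ltW xw)) (le_trans (ltW wy)).
  apply/negP; rewrite -ltNge -(pmulr_lgt0 _ (_ : 0 < y - x)) ?subr_gt0//.
  by rewrite -ZE.
have Zmy w : x <= w <= b -> Z w t <= Z y t.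
  move=> /andP[xw wb]; rewrite -(lerD2r (- Z x t)); apply: Zm => //.
  by rewrite (le_trans ax).
have Zmx w : a <= w <= y -> Z x t <= Z w t.
  move=> /andP[aw wy]; rewrite -lerN2 -(lerD2l (Z y t)); apply: Zm => //.
  by rewrite aw (le_trans wy).
(* The lateral conditions exclude an endpoint of the interval at [y] and [x],
   since the derivative of [Z] has the wrong sign there. *)
have zy0 : 0 <= z y t.
  apply: (derive_ge0_left_max xy (dZ _ _ yab tst)) => w /andP[xw wy].
  by rewrite Zmy// (ltW xw) (le_trans (ltW wy)).
have {yb}yb : y < b.
  rewrite lt_neqAle yb andbT; apply/eqP => yE.
  by have := pb _ tst; rewrite -yE -subr_lt0 ltNge zy0.
have {zy0}zy0 : z y t = 0.
  apply/eqP; rewrite eq_le zy0 andbT.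
  apply: (derive_le0_right_max yb (dZ _ _ yab tst)) => w /andP[yw wb].
  by rewrite Zmy// (ltW wb) (ltW (lt_trans xy yw)).
have dNZ w : a <= w <= b -> is_derive w 1 (fun r : R => - Z r t) (- z w t).
  by move=> wab; apply: is_deriveN; exact: dZ.
have zx0 : 0 <= z x t.
  rewrite -oppr_le0; apply: (derive_le0_right_max xy (dNZ _ xab)) => w /andP[xw wy].
  by rewrite lerN2 Zmx// (ltW wy) (le_trans ax (ltW xw)).
have {ax}ax : a < x.
  rewrite lt_neqAle ax andbT; apply/eqP => xE.
  by have := pa _ tst; rewrite xE -subr_lt0 ltNge zx0.
have {zx0}zx0 : z x t = 0.
  apply/eqP; rewrite eq_le zx0 andbT -oppr_ge0.
  apply: (derive_ge0_left_max ax (dNZ _ xab)) => w /andP[aw wx].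
  by rewrite lerN2 Zmx// (ltW aw) (ltW (lt_trans wx xy)).
have qy : q (y, t) - D y t <= 0.
  apply: (@critical_flux_le0 _ (Z^~ t) (z^~ t) _ _ _ _ yb _ _ _
    (W0 _ _ zy0) (dW _ _ yab tst)) => w.
  - by move=> /andP[yw wb]; apply: dZ => //; rewrite (le_trans ay yw) ltW.
  - by move=> /andP[yw wb]; rewrite Zmy// (ltW wb) (ltW (lt_trans xy yw)).
  - move=> /andP[yw wb] /=.
    have wab : a <= w <= b by rewrite (le_trans ay (ltW yw)) ltW.
    by rewrite Wz.
have qx : - (q (x, t) - D x t) <= 0.
  have Wx0 : - W x t = 0 by rewrite (W0 _ _ zx0) oppr0.
  apply: (@critical_flux_le0 _ (fun r => - Z r t) (fun r => - z r t) _ _ _ _ xy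
    _ _ _ Wx0 (is_deriveN (dW _ _ xab tst))) => w.
  - by move=> /andP[xw wy]; apply: dNZ; rewrite (le_trans (ltW ax) xw) ltW// (lt_trans wy).
  - move=> /andP[xw wy].
    by rewrite lerN2 Zmx// (ltW wy) (ltW (lt_trans ax xw)).
  - move=> /andP[xw wy] /=.
    have wab : a <= w <= b.
      by rewrite (ltW (lt_trans ax xw)) ltW// (lt_trans wy).
    by rewrite !oppr_gt0 Wz'.
have tq : c * (y - x) <= q (y, t) - q (x, t).
  apply: (time_derivative_at_max flow _ _ s00 st (le_lt_trans tt0 t0T)).
  - by rewrite (lt_trans x1a ax)/= (le_lt_trans xb).
  - by rewrite (lt_le_trans x1a ay)/= (lt_trans yb).
  move=> s /andP[s0s st']; have := Zm x y s xab yab.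
  rewrite (ltW s0s) (le_trans (ltW st') tt0) (ltW xy) => /(_ isT isT).
  by rewrite /Z; clear; lra.
have := Dc x y t (ltW ax) xy (ltW yb) tst; clear -tq qx qy; lra.
Qed.

(** If a function [g] touches the flux from above at [(x0, t0)] among times
[t <= t0], and [g_t > f1 g_xx] there, then a test function [B] for the slope,
quadratic in [x] and affine in [t], can be inserted: its coefficients are chosen
so that [f B] touches [g] from above and [B_t > (f B)_xx] still holds at the
contact point.  Then [p < B] on the parabolic boundary of a small box, with a
gap by compactness, and lowering [B] by less than this gap contradicts
[local_comparison] at [(x0, t0)]. *)
Lemma flux_viscosity_subsolution (R : realType) (f f1 f2 : R -> R)
    (x1 x2 T : R) (u p q : R * R -> R) (x0 t0 : R)
    (g gt : R -> R -> R) (gx gxx : R -> R) :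
    gradient_flow f x1 x2 T u p q ->
    (forall x : R, is_derive x 1 f (f1 x)) ->
    (forall x : R, is_derive x 1 f1 (f2 x)) ->
    continuous f2 ->
    (forall s : R, 0 < s < 1 -> 0 < f1 s) ->
    x1 < x0 < x2 -> 0 < t0 < T -> 0 < p (x0, t0) < 1 ->
    (forall x t : R, is_derive t 1 (g x) (gt x t)) ->
    continuous (fun w : R * R => gt w.1 w.2) ->
    (forall x : R, is_derive x 1 (g^~ t0) (gx x)) ->
    (forall x : R, is_derive x 1 gx (gxx x)) ->
    continuous gxx ->
    f (p (x0, t0)) = g x0 t0 ->
    (\forall w \near (x0, t0), w.2 <= t0 -> f (p w) <= g w.1 w.2) ->
  gt x0 t0 <= f1 (p (x0, t0)) * gxx x0.
Proof.
move=> flow df df1 f2c f1gt0 x0x t0T b001 dgt gtc dgx dgxx gxxc fg touch.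
rewrite leNgt; apply/negP => strict.
pose b0 := p (x0, t0); rewrite -/b0 in strict fg b001.
have f1b0 : 0 < f1 b0 by exact: f1gt0.
have f1b0n : f1 b0 != 0 by rewrite gt_eqF.
have f1c : continuous f1 := derive_continuous df1.
(* [c] is the time slope of the test function and [N] the value of [(f B)_xx] at
   the contact point; the strict inequality leaves room for
   [gxx < N < c < gt / f1]. *)
pose r := gt x0 t0 / f1 b0.
have rgxx : gxx x0 < r by rewrite ltr_pdivlMr// mulrC.
pose c := (gxx x0 + 2 * r) / 3.
pose N := (2 * gxx x0 + r) / 3.
have [gN Nc cr] : [/\ gxx x0 < N, N < c & c < r] by rewrite /N /c; split; lra.
(* [b1] makes [f B] tangent to [g]; [b2] solves [(f B)_xx = N]. *)
pose b1 := gx x0 / f1 b0.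
pose b2 := (N - f2 b0 * (b1 * b1)) / (2 * f1 b0).
pose B x t := b0 + b1 * (x - x0) + b2 * ((x - x0) * (x - x0)) + c * (t - t0).
pose B' x := b1 + 2 * b2 * (x - x0).
(* [S (B x t) x] is [(f B)_xx]. *)
pose S s x := f1 s * (2 * b2) + f2 s * (B' x * B' x).
have B00 : B x0 t0 = b0 by rewrite /B !subrr; ring.
have S00 : S b0 x0 = N.
  by rewrite /S /B' subrr mulr0 addr0 /b2; field; rewrite f1b0n.
have dBx (x t : R) : is_derive x 1 (B^~ t) (B' x).
  by rewrite /B; apply: is_derive_eq; rewrite /B' /GRing.scale/=; ring.
have dBt (x t : R) : is_derive t 1 (B x) c.
  by rewrite /B; apply: is_derive_eq; rewrite /GRing.scale/=; ring.
have dB' (x : R) : is_derive x 1 B' (2 * b2).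
  by rewrite /B'; apply: is_derive_eq; rewrite /GRing.scale/=; ring.
have Bc : continuous (fun w : R * R => B w.1 w.2).
  move=> w; have c1 : (fun v : R * R => v.1 - x0) @ w --> w.1 - x0.
    by apply: cvgB; [exact: cvg_fst|exact: cvg_cst].
  rewrite /B; apply: cvgD; first apply: cvgD; first apply: cvgD.
  - exact: cvg_cst.
  - by apply: cvgM; [exact: cvg_cst|].
  - by apply: cvgM; [exact: cvg_cst|exact: cvgM].
  - apply: cvgM; first exact: cvg_cst.
    by apply: cvgB; [exact: cvg_snd|exact: cvg_cst].
have B'c : continuous B' := derive_continuous dB'.
have Sc (X : topologicalType) (s x : X -> R) :
    continuous s -> continuous x -> continuous (fun w => S (s w) (x w)).
  move=> sc xc w; rewrite /S.
  have B'w : B' (x v) @[v --> w] --> B' (x w).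
    by apply: (continuous_comp (xc w)); exact: B'c.
  apply: cvgD; apply: cvgM.
  - by apply: (continuous_comp (sc w)); exact: f1c.
  - exact: cvg_cst.
  - by apply: (continuous_comp (sc w)); exact: f2c.
  - exact: cvgM.
(* The third variable is the amount by which [B] will be lowered. *)
have near1 : \forall w \near (x0, t0, 0 : R),
    0 < B w.1.1 w.1.2 - w.2 < 1 /\ S (B w.1.1 w.1.2 - w.2) w.1.1 < c.
  have Byc : continuous (fun w : R * R * R => B w.1.1 w.1.2 - w.2).
    move=> w; apply: cvgB; last exact: cvg_snd.
    by apply: (@continuous_comp _ _ _ fst (fun w => B w.1 w.2)); [exact: cvg_fst|exact: Bc].
  have xc : continuous (fun w : R * R * R => w.1.1).
    by move=> w; apply: continuous_comp; exact: cvg_fst.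
  have Byv : B x0 t0 - 0 = b0 by rewrite B00 subr0.
  have Bl := Byc (x0, t0, 0); rewrite /continuous_at/= Byv in Bl.
  have Sl := Sc _ _ _ Byc xc (x0, t0, 0); rewrite /continuous_at/= Byv S00 in Sl.
  have [b0gt b0lt] := andP b001.
  near=> w; split; first (apply/andP; split).
  - near: w; exact: (@cvgr_gt _ _ _ _ _ _ Bl _ b0gt).
  - near: w; exact: (@cvgr_lt _ _ _ _ _ _ Bl _ b0lt).
  - near: w; exact: (@cvgr_lt _ _ _ _ _ _ Sl _ Nc).
have near2 : \forall w \near (x0, t0), [/\ 0 < p w < 1,
    f1 (B w.1 w.2) * c < gt w.1 w.2, gxx w.1 < S (B w.1 t0) w.1,
    w.2 <= t0 -> f (p w) <= g w.1 w.2 & cylinder x1 x2 T w].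
  have [cyl pl] := flow_slope_continuous flow x0x t0T.
  have [b0gt b0lt] := andP b001.
  have l1 : gt w.1 w.2 - f1 (B w.1 w.2) * c @[w --> (x0, t0)] -->
      gt x0 t0 - f1 b0 * c.
    apply: cvgB; first exact: (gtc (x0, t0)).
    apply: cvgM; last exact: cvg_cst.
    by rewrite -B00; apply: (continuous_comp (Bc (x0, t0))); exact: f1c.
  have l2 : S (B w.1 t0) w.1 - gxx w.1 @[w --> (x0, t0)] --> N - gxx x0.
    rewrite -S00 -B00; apply: cvgB.
      apply: (Sc _ (fun w : R * R => B w.1 t0) fst _ _ (x0, t0)).
        move=> w; apply: (@continuous_comp _ _ _ fst (B^~ t0)); first exact: cvg_fst.
        by apply: derive_continuous => x; exact: dBx.
      by move=> w; exact: cvg_fst.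
    by apply: (@continuous_comp _ _ _ fst gxx (x0, t0)); [exact: cvg_fst|exact: gxxc].
  have l1gt : 0 < gt x0 t0 - f1 b0 * c by rewrite subr_gt0 mulrC -ltr_pdivlMr.
  have l2gt : 0 < N - gxx x0 by rewrite subr_gt0.
  near=> w; split.
  - apply/andP; split; near: w.
      exact: (@cvgr_gt _ _ _ _ _ _ pl _ b0gt).
    exact: (@cvgr_lt _ _ _ _ _ _ pl _ b0lt).
  - rewrite -subr_gt0; near: w; exact: (@cvgr_gt _ _ _ _ _ _ l1 _ l1gt).
  - rewrite -subr_gt0; near: w; exact: (@cvgr_gt _ _ _ _ _ _ l2 _ l2gt).
  - by near: w.
  - by near: w.
have [d1 d1gt0 {}near1] := near_box3 near1.
have [d2 d2gt0 {}near2] := near_box near2.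
pose d := Num.min d1 d2.
have dgt0 : 0 < d by rewrite lt_min d1gt0.
have [dd1 dd2] : d <= d1 /\ d <= d2 by rewrite !ge_min !lexx orbT.
have {}near1 x t y : x0 - d <= x <= x0 + d -> t0 - d <= t <= t0 ->
    - d <= y <= d -> 0 < B x t - y < 1 /\ S (B x t - y) x < c.
  move=> /andP[xl xr] /andP[tl tr] /andP[yl yr].
  by apply: near1; clear -dd1 dgt0 xl xr tl tr yl yr; apply/andP; split; lra.
have {}near2 x t : x0 - d <= x <= x0 + d -> t0 - d <= t <= t0 -> [/\ 0 < p (x, t) < 1,
    f1 (B x t) * c < gt x t, gxx x < S (B x t0) x,
    f (p (x, t)) <= g x t & cylinder x1 x2 T (x, t)].
  move=> /andP[xl xr] /andP[tl tr]; have [||? ? ? pg ?] := near2 x t.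
  - by clear -dd2 dgt0 xl xr tl tr; apply/andP; split; lra.
  - by clear -dd2 dgt0 xl xr tl tr; apply/andP; split; lra.
  - by split => //; exact: pg.
have t0d : t0 - d <= t0 <= t0 by rewrite lexx gerBl ltW.
(* At time [t0] the difference [f B - g] is strictly convex in [x] with a zero
   minimum at [x0]; it decreases in time up to [t0]. *)
have Bt0 : forall x, x0 - d <= x <= x0 + d -> x != x0 -> g x t0 < f (B x t0).
  pose h1 x := f1 (B x t0) * B' x - gx x.
  move=> x xd xx0; rewrite -subr_gt0.
  have h00 : f (B x0 t0) - g x0 t0 = 0 by rewrite B00 fg subrr.
  rewrite -[X in X < _]h00.
  apply: (@strict_convex_min _ (fun x => f (B x t0) - g x t0) h1
            (fun x => S (B x t0) x - gxx x) x0 d) => //.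
  - move=> y _; rewrite /h1.
    have dd := @is_derive1_comp _ f1 (B^~ t0) y _ _ (df1 _) (dBx _ _).
    have ddd := is_deriveB (is_deriveM dd (dB' y)) (dgxx y).
    by apply: is_derive_eq; rewrite /S /GRing.scale/=; ring.
  - by move=> y yd; rewrite subr_gt0; have [] := near2 y t0 yd t0d.
  - by rewrite /h1 B00 /B' subrr mulr0 addr0 /b1 mulrC divfK ?subrr.
have Bt x t : x0 - d <= x <= x0 + d -> t0 - d <= t < t0 -> g x t < f (B x t).
  move=> xd /andP[td tt].
  have [s /andP[ts st] hE] :=
    @mean_value _ (fun t => f (B x t) - g x t) (fun t => f1 (B x t) * c - gt x t) _ _ tt.
  have [_ lt _ _ _] : [/\ 0 < p (x, s) < 1,
    f1 (B x s) * c < gt x s, gxx x < S (B x t0) x,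
    f (p (x, s)) <= g x s & cylinder x1 x2 T (x, s)].
    by apply: near2 => //; rewrite (ltW st) (le_trans td (ltW ts)).
  have : (f1 (B x s) * c - gt x s) * (t0 - t) < 0.
    by rewrite nmulr_rlt0 ?subr_lt0 ?subr_gt0.
  rewrite -hE.
  have : g x t0 <= f (B x t0).
    have [->|] := eqVneq x x0; first by rewrite B00 fg.
    by move=> xx0; rewrite ltW// Bt0.
  by lra.
have fJ := pos_derive_mono df f1gt0.
have J01 s : 0 < s < 1 -> s \in `[0, 1].
  by move=> /andP[? ?]; rewrite in_itv/= !ltW.
have pB x t : x0 - d <= x <= x0 + d -> t0 - d <= t <= t0 ->
    g x t < f (B x t) -> p (x, t) < B x t.
  move=> xd td gB; have [p01 _ _ fpg _] := near2 _ _ xd td.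
  have [|B01 _] := near1 x t 0 xd td.
    by rewrite oppr_le0 (ltW dgt0).
  rewrite subr0 in B01.
  by rewrite -fJ ?J01// (le_lt_trans fpg).
pose a := x0 - d; pose b := x0 + d; pose s0 := t0 - d.
have aab : a <= a <= b by clear -dgt0; apply/andP; rewrite /a /b; split; lra.
have bab : a <= b <= b by clear -dgt0; apply/andP; rewrite /a /b; split; lra.
have sst : s0 <= s0 <= t0 by rewrite lexx; case/andP: t0d.
have [x1a bx2 s00 t0T'] : [/\ x1 < a, b < x2, 0 <= s0 & t0 < T].
  have [_ _ _ _ []] := near2 a s0 aab sst; rewrite /= !in_itv/= => /andP[? _] /andP[? _].
  have [_ _ _ _ []] := near2 b s0 bab sst; rewrite /= !in_itv/= => /andP[_ ?] _.
  by split => //; case/andP: t0T.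
have [uc pc _ _ _] := flow.
pose h (w : R * R) := p (clamp a b w.1, clamp s0 t0 w.2) - B w.1 w.2.
have hc : continuous h.
  move=> w; apply: cvgB; last exact: Bc.
  apply: (continuous_clamp2 pc) => //; first by case/andP: aab.
  by case/andP: sst.
(* On the box this product is nonnegative, and it vanishes exactly on the
   parabolic boundary. *)
have gc : continuous (fun w : R * R => - ((w.1 - a) * (b - w.1) * (w.2 - s0))).
  move=> w; apply: cvgN; apply: cvgM; first apply: cvgM.
  - by apply: cvgB; [exact: cvg_fst|exact: cvg_cst].
  - by apply: cvgB; [exact: cvg_cst|exact: cvg_fst].
  - by apply: cvgB; [exact: cvg_snd|exact: cvg_cst].
have := EVT_superlevel (compact_setX (@compact_segment R a b) (@compact_segment R s0 t0)) gc hc.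
case.
  by exists (a, s0); [split|rewrite /= subrr !mul0r oppr0].
move=> [x t] [] [/= xab tst] bd hm.
have hE y s : a <= y <= b -> s0 <= s <= t0 -> h (y, s) = p (y, s) - B y s.
  by move=> yab sst'; rewrite /h /= !clamp_id.
have hneg : h (x, t) < 0.
  rewrite hE// subr_lt0; apply: pB => //.
  have [tt0|t0t] := ltP t t0; first by apply: Bt => //; rewrite tt0; case/andP: tst => ->.
  have {t0t}tE : t = t0 by apply/eqP; rewrite eq_le t0t andbT; case/andP: tst.
  rewrite tE; apply: Bt0 => //; apply/eqP => xE; move: bd.
  rewrite xE tE /a /b /s0 => bd.
  have : 0 < d * d * d by rewrite !mulr_gt0.
  have -> : d * d * d = (x0 - (x0 - d)) * (x0 + d - x0) * (t0 - (t0 - d)) by ring.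
  clear -bd; lra.
pose y := Num.min (- h (x, t) / 2) d.
have [y0 yd yh] : [/\ 0 < y, y <= d & y < - h (x, t)].
  rewrite /y lt_min ge_min gt_min lexx orbT dgt0.
  by clear -hneg; split => //; [apply/andP; split => //; lra|apply/orP; left; lra].
have yd' : - d <= y <= d by rewrite yd andbT; clear -y0 dgt0; lra.
have bdy y' s : a <= y' <= b -> s0 <= s <= t0 ->
    0 <= - ((y' - a) * (b - y') * (s - s0)) -> p (y', s) < B y' s - y.
  move=> yab sst' nb; have := hm (y', s); rewrite hE// => /(_ (conj yab sst') nb).
  by clear -yh; lra.
pose P z := b0 - c * t0 - y + b1 * (z - x0) + b2 * ((z - x0) * (z - x0)).
pose Q z := (b0 - c * t0 - y) * z + b1 / 2 * ((z - x0) * (z - x0))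
            + b2 / 3 * ((z - x0) * ((z - x0) * (z - x0))).
have PB z s : P z + c * s = B z s - y by rewrite /P /B; ring.
have dQ (z : R) : is_derive z 1 Q (P z).
  by rewrite /Q /P; apply: is_derive_eq; rewrite /GRing.scale/=; field.
have dP (z s : R) : is_derive z 1 (fun z => P z + c * s) (B' z).
  by rewrite /P /B'; apply: is_derive_eq; rewrite /GRing.scale/=; ring.
have dfP (z s : R) : is_derive z 1 (fun z => f (P z + c * s)) (f1 (P z + c * s) * B' z).
  exact: (@is_derive1_comp _ f (fun z => P z + c * s) z _ _ (df _) (dP z s)).
have dfP2 (z s : R) :
    is_derive z 1 (fun z => f1 (P z + c * s) * B' z) (S (P z + c * s) z).
  have dd := @is_derive1_comp _ f1 (fun z => P z + c * s) z _ _ (df1 _) (dP _ _).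
  have ddd := is_deriveM dd (dB' z).
  by apply: is_derive_eq; rewrite /S /GRing.scale/=; ring.
have cmp : p (x0, t0) <= P x0 + c * t0.
  apply: (@local_comparison R f `[0, 1] x1 x2 T u p q a b s0 t0 Q P c
    (fun z s => f1 (P z + c * s) * B' z)) => //.
  - move=> z s zab sst'; have [p01 _ _ _ _] := near2 _ _ zab sst'.
    by have [B01 _] := near1 _ _ _ zab sst' yd'; rewrite PB !J01.
  - move=> z z' s az zz' zb sst'.
    have [v /andP[zv vz] ->] := mean_value zz' (fun v _ => dfP2 v s).
    rewrite ltr_pM2r ?subr_gt0// PB.
    have vab : a <= v <= b by rewrite (le_trans az (ltW zv)) (le_trans (ltW vz)).
    by have [_] := near1 v s y vab sst' yd'.
  - by move=> s sst'; rewrite PB; apply: bdy; rewrite // subrr !mul0r oppr0.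
  - by move=> s sst'; rewrite PB; apply: bdy; rewrite // subrr mulr0 mul0r oppr0.
  - by move=> z zab; rewrite PB ltW//; apply: bdy; rewrite // subrr mulr0 oppr0.
  - by rewrite /a /b gerBl lerDl ltW.
move: cmp; rewrite PB B00 -/b0; clear -y0; lra.
Unshelve. all: by end_near. Qed.

(** * Persistence of the subcritical region *)

(** The deficit [E = f 1 - f p] is computed with the slope clipped to [[0, 1]]:
it is then nonnegative for every slope, vanishes exactly when [p >= 1], and
agrees with the unclipped one where [0 < p < 1].  The barrier is
[psi t * F x - eps]; with [C] a bound of [f1] on [(0, 1)], the choice
[k r^2 = 9 C + r^2] makes it a strict subsolution. *)
Lemma subcritical_persists (R : realType) (f f1 f2 : R -> R)
    (x1 x2 T x3 x4 : R) (u p q : R * R -> R) :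
    gradient_flow f x1 x2 T u p q ->
    (forall x : R, is_derive x 1 f (f1 x)) ->
    (forall x : R, is_derive x 1 f1 (f2 x)) ->
    continuous f2 ->
    (forall s : R, 0 < s < 1 -> 0 < f1 s) ->
    (forall s : R, 0 < s -> f s <= f 1) ->
    x1 <= x3 -> x4 <= x2 ->
    (forall x : R, x3 < x < x4 -> p (x, 0) < 1) ->
  forall x t : R, x3 < x < x4 -> 0 <= t < T -> p (x, t) < 1.
Proof.
move=> flow df df1 f2c f1gt0 fmax x13 x42 init xc tc /andP[x3c xc4] /andP[tc0 tcT].
have [uc pc _ _ vx] := flow.
have fJ := pos_derive_mono df f1gt0.
have fc := derive_continuous df; have f1c := derive_continuous df1.
have [r [r0 x3l rx4]] : exists r, [/\ 0 < r, x3 < xc - r & xc + r < x4].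
  exists (Num.min ((xc - x3) / 2) ((x4 - xc) / 2)); split.
  - by rewrite lt_min; apply/andP; split; lra.
  - have : Num.min ((xc - x3) / 2) ((x4 - xc) / 2) <= (xc - x3) / 2 by rewrite ge_min lexx.
    by lra.
  - have : Num.min ((xc - x3) / 2) ((x4 - xc) / 2) <= (x4 - xc) / 2 by rewrite ge_min lexx orbT.
    by lra.
pose a := xc - r; pose b := xc + r.
have [ab x1a bx2] : [/\ a <= b, x1 < a & b < x2] by rewrite /a /b; split; lra.
pose E (w : R * R) := f 1 - f (clamp 0 1 (p (clamp a b w.1, clamp 0 tc w.2))).
have Ec : continuous E.
  move=> w; apply: cvgB; first exact: cvg_cst.
  apply: (@continuous_comp _ _ _ (fun w => clamp 0 1 (p (clamp a b w.1, clamp 0 tc w.2))) f);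
    last exact: fc.
  apply: (@continuous_comp _ _ _ (fun w => p (clamp a b w.1, clamp 0 tc w.2)) (clamp 0 1));
    last exact: continuous_clamp.
  exact: (continuous_clamp2 pc).
have EE x t : a <= x <= b -> 0 <= t <= tc -> E (x, t) = f 1 - f (clamp 0 1 (p (x, t))).
  by move=> xab t0; rewrite /E /= (clamp_id xab) (clamp_id t0).
have in01 (s : R) : clamp 0 1 s \in `[0, 1] by rewrite in_itv/= clamp_bounds.
have one01 : (1 : R) \in `[0, 1] by rewrite in_itv/= ler01 lexx.
have zero01 : (0 : R) \in `[0, 1] by rewrite in_itv/= ler01 lexx.
have clamp_lt1 (s : R) : (clamp 0 1 s < 1) = (s < 1).
  by rewrite /clamp gt_max ltr01 gt_min ltxx orbF.
have clamp_gt0 (s : R) : (0 < clamp 0 1 s) = (0 < s).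
  by rewrite /clamp lt_max ltxx lt_min ltr01 andbT.
have Egt0 x t : a <= x <= b -> 0 <= t <= tc -> (0 < E (x, t)) = (p (x, t) < 1).
  by move=> xab t0; rewrite EE// subr_gt0 fJ ?in01 ?one01// clamp_lt1.
have Ege0 w : 0 <= E w.
  rewrite subr_ge0; have := in01 (p (clamp a b w.1, clamp 0 tc w.2)).
  rewrite in_itv/= => /andP[_]; rewrite le_eqVlt => /predU1P[->//|lt1].
  by rewrite ltW// fJ ?in01 ?one01.
have [m mab Emin] : exists2 m, a <= m <= b & forall x, a <= x <= b -> E (m, 0) <= E (x, 0).
  have E0c : continuous (fun x => E (x, 0)).
    move=> x; apply: (@continuous_comp _ _ _ (fun x : R => (x, 0 : R)) E); last exact: Ec.
    exact: (cvg_pair (@cvg_id _ (nbhs x)) (cvg_cst (0 : R))).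
  have [m mab hm] := EVT_min ab (continuous_subspaceT E0c).
  by exists m => [|x xab]; [rewrite in_itv/= in mab|apply: hm; rewrite in_itv].
pose mu := E (m, 0).
have tc00 : 0 <= (0 : R) <= tc by rewrite lexx.
have mu0 : 0 < mu.
  rewrite /mu Egt0//; apply: init; move: mab; rewrite /a /b => /andP[? ?].
  by apply/andP; split; lra.
have [C C0 f1C] : exists2 C, 0 < C & forall s, 0 < s < 1 -> f1 s <= C.
  have [m' _ hm'] := EVT_max ler01 (continuous_subspaceT f1c).
  have half : 0 < f1 (1 / 2) by apply: f1gt0; lra.
  exists (f1 m') => [|s /andP[s0 s1]]; last by apply: hm'; rewrite in_itv/= !ltW.
  by apply: (lt_le_trans half); apply: hm'; rewrite in_itv/=; lra.
pose r2 := r * r; have r20 : 0 < r2 by rewrite mulr_gt0.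
pose k := 9 * C / r2 + 1.
have kr2 : k * r2 = 9 * C + r2 by rewrite /k mulrDl divfK ?mul1r ?gt_eqF.
have k0 : 0 < k by rewrite addr_gt0// divr_gt0// mulr_gt0.
pose A := mu / (r2 * r2).
have A0 : 0 < A by rewrite divr_gt0// mulr_gt0.
have Ar : A * (r2 * r2) = mu by rewrite divfK// gt_eqF// mulr_gt0.
pose F x := (r2 - (x - xc) * (x - xc)) * (r2 - (x - xc) * (x - xc)).
pose F' x := - 4 * ((x - xc) * (r2 - (x - xc) * (x - xc))).
pose F'' x := 12 * ((x - xc) * (x - xc)) - 4 * r2.
have dF (x : R) : is_derive x 1 F (F' x).
  by rewrite /F; apply: is_derive_eq; rewrite /F' /GRing.scale/=; ring.
have dF' (x : R) : is_derive x 1 F' (F'' x).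
  by rewrite /F'; apply: is_derive_eq; rewrite /F'' /GRing.scale/=; ring.
have dF'' (x : R) : is_derive x 1 F'' (24 * (x - xc)).
  by rewrite /F''; apply: is_derive_eq; rewrite /GRing.scale/=; ring.
(* Half of the central height of the barrier at the final time: the barrier stays
   positive at [(xc, tc)], and its zero level never reaches the centre, where it
   would have no slope. *)
pose eps := A * expR (- (k * tc)) * (r2 * r2) / 2.
have eps0 : 0 < eps.
  apply: divr_gt0 => //; apply: mulr_gt0; last exact: mulr_gt0.
  by apply: mulr_gt0 => //; exact: expR_gt0.
pose psi t := A * expR (- (k * t)).
have psi0 t : 0 < psi t by rewrite mulr_gt0 ?expR_gt0.
have dpsi (t : R) : is_derive t 1 psi (- (k * psi t)).
  have dkt : is_derive t 1 (fun s : R => - (k * s)) (- k).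
    by apply: is_derive_eq; rewrite /GRing.scale/=; ring.
  have dd := @is_derive1_comp _ expR (fun s : R => - (k * s)) t _ _ (is_derive_expR _) dkt.
  have ddd : is_derive t 1 (fun s => A * expR (- (k * s))) (A * (expR (- (k * t)) * - k)).
    exact: (is_deriveZ A dd).
  by apply: is_derive_eq; rewrite /psi; ring.
have psi_le t : 0 <= t -> psi t <= A.
  move=> t0; rewrite -[leRHS]mulr1 ler_pM2l// -expR0 ler_expR oppr_le0.
  by rewrite mulr_ge0// ltW.
have eps_le t : t <= tc -> eps <= psi t * (r2 * r2) / 2.
  move=> ttc; rewrite /eps ler_pM2r ?invr_gt0// ler_pM2r ?mulr_gt0//.
  by rewrite ler_pM2l// ler_expR lerN2 ler_pM2l.
have Fle x : a <= x <= b -> 0 <= r2 - (x - xc) * (x - xc).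
  rewrite /a /b => /andP[ax xb].
  have -> : r2 - (x - xc) * (x - xc) = (x - (xc - r)) * (xc + r - x) by rewrite /r2; ring.
  by rewrite mulr_ge0 ?subr_ge0.
have FleX x : a <= x <= b -> F x <= r2 * r2.
  move=> xab; have := Fle _ xab; have : 0 <= (x - xc) * (x - xc) by rewrite -expr2 sqr_ge0.
  by move=> X0 Y0; rewrite ler_pM//; clear -X0 Y0; lra.
pose D (w : R * R) := E w - (psi w.2 * F w.1 - eps).
have psic := derive_continuous dpsi; have Fc := derive_continuous dF.
have Dc : continuous D.
  move=> w; apply: cvgB; first exact: Ec.
  apply: cvgB; last exact: cvg_cst.
  apply: cvgM.
    by apply: (@continuous_comp _ _ _ snd psi); [exact: cvg_snd|exact: psic].
  by apply: (@continuous_comp _ _ _ fst F); [exact: cvg_fst|exact: Fc].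
suff Dgt0 x t : a <= x <= b -> 0 <= t <= tc -> 0 < D (x, t).
  have xcab : a <= xc <= b by clear -r0; rewrite /a /b; apply/andP; split; lra.
  have tctc : 0 <= tc <= tc by rewrite tc0 lexx.
  have := Dgt0 _ _ xcab tctc; rewrite -(Egt0 xc tc)// /D /= subr_gt0; apply: lt_trans.
  rewrite subr_gt0 /F subrr mulr0 subr0 /eps -/(psi tc).
  have : 0 < psi tc * (r2 * r2) by apply: mulr_gt0; [exact: psi0|exact: mulr_gt0].
  by clear; lra.
move=> xab ttc; rewrite ltNge; apply/negP => Dle.
(* Maximizing [- t] over the contact set gives the first contact time. *)
have NDc : continuous (fun w => - D w) by move=> w; apply: cvgN; exact: Dc.
have tNc : continuous (fun w : R * R => - w.2) by move=> w; apply: cvgN; exact: cvg_snd.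
have := EVT_superlevel (compact_setX (@compact_segment R a b) (@compact_segment R 0 tc)) NDc tNc.
case; first by exists (x, t); rewrite ?oppr_ge0.
move=> [x0 t0] [] [/= x0ab t0tc]; rewrite oppr_ge0 => D0 tmin {x t xab ttc Dle}.
have before x t : a <= x <= b -> 0 <= t < t0 -> 0 < D (x, t).
  move=> xab /andP[t00 tt0]; rewrite ltNge; apply/negP => Dxt.
  have ttc : 0 <= t <= tc by rewrite t00 (le_trans (ltW tt0))//; case/andP: t0tc.
  have := tmin (x, t) (conj xab ttc); rewrite oppr_ge0 => /(_ Dxt).
  by rewrite /= lerN2 leNgt tt0.
have /andP[t00 t0c] := t0tc.
have {t00}t00 : 0 < t0.
  rewrite lt_neqAle t00 andbT; apply/eqP => t0E.
  move: D0; rewrite -t0E /D /= leNgt => /negP; apply.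
  have := Emin _ x0ab; rewrite -/mu -Ar => Emu.
  have : psi 0 * F x0 <= A * (r2 * r2).
    apply: ler_pM; rewrite ?(ltW (psi0 _)) ?psi_le ?FleX//.
    by rewrite mulr_ge0 ?Fle.
  by clear -Emu eps0; lra.
have at_t0 x : a <= x <= b -> 0 <= D (x, t0).
  move=> xab; rewrite leNgt; apply/negP => Dx.
  have Dxc : D (x, s) @[s --> t0] --> D (x, t0).
    apply: (@continuous_comp _ _ _ (fun s => (x, s)) D); last exact: Dc.
    exact: (cvg_pair (cvg_cst x) (@cvg_id _ (nbhs t0))).
  have [s /andP[s0 st]] := near_left_pick t00 (@cvgr_lt _ _ _ _ _ _ Dxc _ Dx).
  move=> /(_ s); rewrite lexx (ltW st) => /(_ isT).
  by rewrite ltNge ltW// before// (ltW s0).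
have {}D0 : D (x0, t0) = 0 by apply/eqP; rewrite eq_le D0 at_t0.
have upto x t : a <= x <= b -> 0 <= t <= t0 -> 0 <= D (x, t).
  move=> xab /andP[t0' tt]; move: tt; rewrite le_eqVlt => /predU1P[->|tt]; first exact: at_t0.
  by rewrite ltW// before// t0'.
have E0 : E (x0, t0) = psi t0 * F x0 - eps by apply/subr0_eq.
have F0 : 0 < F x0.
  rewrite -(pmulr_rgt0 _ (psi0 t0)); have := Ege0 (x0, t0); rewrite E0; clear -eps0; lra.
have [ax0 x0b] : a < x0 /\ x0 < b.
  have [ax xb] := andP x0ab; rewrite !lt_neqAle ax xb !andbT; split; apply/eqP => xE.
    by move: F0; rewrite /F -xE /a /r2 (_ : r * r - _ = 0) ?mul0r ?ltxx//; ring.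
  by move: F0; rewrite /F xE /b /r2 (_ : r * r - _ = 0) ?mul0r ?ltxx//; ring.
have x0x : x1 < x0 < x2 by rewrite (lt_trans x1a ax0) (lt_trans x0b).
have t0T : 0 < t0 < T by rewrite t00 (le_lt_trans t0c).
have [cyl pl] := flow_slope_continuous flow x0x t0T.
have nearab : \forall x \near x0, a <= x <= b.
  have : \forall x \near x0, x \in `]a, b[ by apply: near_in_itvoo; rewrite in_itv/= ax0.
  by apply: filterS => x; rewrite in_itv/= => /andP[? ?]; rewrite !ltW.
have t0tc' : 0 <= t0 <= tc by rewrite (ltW t00) t0c.
pose beta x := psi t0 * F x - eps.
have dbeta (x : R) : is_derive x 1 beta (psi t0 * F' x).
  rewrite /beta; have dd := dF x.
  by apply: is_derive_eq; rewrite /GRing.scale/=; ring.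
have betaE x : a <= x <= b -> beta x <= E (x, t0).
  by move=> xab; rewrite -subr_ge0; exact: at_t0.
have : 0 <= E (x0, t0) by exact: Ege0.
rewrite le_eqVlt => /predU1P[/esym E00|Epos].
  (* The flux is maximal at [x0], while the barrier has a nonzero slope there. *)
  have p1 : 1 <= p (x0, t0) by rewrite leNgt -(Egt0 _ _ x0ab t0tc') E00 ltxx.
  have dbeta0 : psi t0 * F' x0 != 0.
    have x0c : x0 != xc.
      apply/eqP => x0E; have := eps_le _ t0c.
      have : psi t0 * (r2 * r2) = eps.
        by apply/eqP; rewrite -subr_eq0 -E00 E0 x0E /F subrr mulr0 subr0.
      by clear -eps0; lra.
    have r2x0 : r2 - (x0 - xc) * (x0 - xc) != 0.
      by move: F0; rewrite /F; apply: contraTneq => ->; rewrite mul0r ltxx.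
    rewrite /F'; apply: mulf_neq0; first by rewrite gt_eqF.
    apply: mulf_neq0; first by clear; apply/eqP; lra.
    by apply: mulf_neq0 => //; rewrite subr_eq0.
  suff db0 : psi t0 * F' x0 = 0 by move: dbeta0; rewrite db0 eqxx.
  have ppos : \forall x \near x0, 0 < p (x, t0).
    have p0 : 0 < p (x0, t0) by rewrite (lt_le_trans ltr01).
    exact: near_slice (@cvgr_gt _ _ _ _ _ _ pl _ p0).
  have [pgt1|ple1] := ltP 1 (p (x0, t0)).
    have pgt : \forall x \near x0, 1 < p (x, t0).
      exact: near_slice (@cvgr_gt _ _ _ _ _ _ pl _ pgt1).
    apply/eqP; rewrite -oppr_eq0; apply/eqP.
    apply: (derive_eq0_local_min (is_deriveN (dbeta x0))).
    near=> x; rewrite /= lerN2 -[beta x0]/(psi t0 * F x0 - eps) -E0 E00.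
    have xab : a <= x <= b by near: x.
    apply: (le_trans (betaE _ xab)); rewrite leNgt Egt0// -leNgt ltW//.
    by near: x.
  have {p1 ple1}p1 : p (x0, t0) = 1 by apply/eqP; rewrite eq_le ple1.
  have x0cyl : cylinder x1 x2 T (x0, t0) := nbhs_singleton cyl.
  pose e x := f 1 - f (p (x, t0)).
  have de : is_derive x0 1 e (- q (x0, t0)).
    have dd := vx _ _ x0cyl.
    by have := is_deriveB (is_derive_cst (f 1) x0 1) dd; rewrite sub0r.
  have e0 : e x0 = 0 by rewrite /e p1 subrr.
  have q0 : - q (x0, t0) = 0.
    apply: (derive_eq0_local_min de); near=> x.
    by rewrite e0 subr_ge0; apply: fmax; near: x.
  have := derive_eq0_local_min (is_deriveB de (dbeta x0)); rewrite q0 sub0r.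
  move=> qb; apply/eqP; rewrite -oppr_eq0; apply/eqP; apply: qb.
  near=> x; change (e x0 - beta x0 <= e x - beta x).
  rewrite e0 -[beta x0]/(psi t0 * F x0 - eps) -E0 E00 subrr subr_ge0.
  have xab : a <= x <= b by near: x.
  apply: (le_trans (betaE _ xab)); rewrite EE// lerD2l lerN2.
  have px : 0 < p (x, t0) by near: x.
  have [p1x|p1x] := leP (p (x, t0)) 1; first by rewrite clamp_id// p1x ltW.
  have -> : clamp 0 1 (p (x, t0)) = 1.
    by rewrite /clamp (min_idPr (ltW p1x)); apply/max_idPr.
  exact: fmax.
have plt1 : p (x0, t0) < 1 by rewrite -(Egt0 _ _ x0ab t0tc').
(* The barrier stays below the initial minimum [mu] of the deficit, hence below
   the value that the deficit takes at nonpositive slopes. *)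
have pgt0 : 0 < p (x0, t0).
  rewrite -clamp_gt0 -fJ//.
  have mu1 : mu <= f 1 - f 0.
    rewrite /mu EE// lerD2l lerN2; have := in01 (p (m, 0)).
    rewrite in_itv/= => /andP[+ _]; rewrite le_eqVlt => /predU1P[<-//|c0].
    by rewrite ltW// fJ.
  have : E (x0, t0) < mu.
    rewrite E0 -Ar.
    have : psi t0 * F x0 <= A * (r2 * r2).
      apply: ler_pM; rewrite ?(ltW (psi0 _)) ?psi_le ?FleX// ?(ltW F0) ?(ltW t00)//.
    by clear -eps0; lra.
  by rewrite EE//; clear -mu1; lra.
have p01 : 0 < p (x0, t0) < 1 by rewrite pgt0.
pose g x t := f 1 - (psi t * F x - eps).
have visc : k * psi t0 * F x0 <= f1 (p (x0, t0)) * - (psi t0 * F'' x0).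
  apply: (@flux_viscosity_subsolution R f f1 f2 x1 x2 T u p q x0 t0 g
    (fun x t => k * psi t * F x) (fun x => - (psi t0 * F' x))
    (fun x => - (psi t0 * F'' x))) => //.
  - move=> x t; rewrite /g; have dd := dpsi t.
    by apply: is_derive_eq; rewrite /GRing.scale/=; ring.
  - move=> w; apply: cvgM.
      apply: cvgM; first exact: cvg_cst.
      by apply: (@continuous_comp _ _ _ snd psi); [exact: cvg_snd|exact: psic].
    by apply: (@continuous_comp _ _ _ fst F); [exact: cvg_fst|exact: Fc].
  - move=> x; rewrite /g; have dd := dF x.
    by apply: is_derive_eq; rewrite /GRing.scale/=; ring.
  - move=> x; apply: cvgN; apply: cvgM; first exact: cvg_cst.
    exact: (derive_continuous dF'').
  - have : E (x0, t0) = f 1 - f (p (x0, t0)).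
      by rewrite EE// clamp_id// !ltW.
    by rewrite E0 /g; clear; lra.
  - near=> w; move=> wt0.
    have wab : a <= w.1 <= b.
      have : w.1 \in `]a, b[.
        near: w; apply: (@cvg_fst _ _ _ _ _ (`]a, b[%classic)).
        by apply: near_in_itvoo; rewrite in_itv/= ax0.
      by rewrite in_itv/= => /andP[? ?]; rewrite !ltW.
    have w0 : 0 <= w.2 <= t0.
      rewrite wt0 andbT ltW//.
      near: w; exact: (@cvgr_gt _ _ _ _ _ _ (@cvg_snd _ _ _ _ _) _ t00).
    have wtc : 0 <= w.2 <= tc by case/andP: w0 => -> /= /le_trans; apply.
    have pw0 : 0 < p w by near: w; exact: (@cvgr_gt _ _ _ _ _ _ pl _ pgt0).
    have pw1 : p w < 1 by near: w; exact: (@cvgr_lt _ _ _ _ _ _ pl _ plt1).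
    have := upto _ _ wab w0; rewrite /D EE//= -surjective_pairing clamp_id.
      by rewrite /g; clear; lra.
    by rewrite (ltW pw0) (ltW pw1).
have {visc}visc : k * F x0 <= f1 (p (x0, t0)) * - F'' x0.
  rewrite -(ler_pM2l (psi0 t0)).
  have -> : psi t0 * (k * F x0) = k * psi t0 * F x0 by ring.
  by rewrite (le_trans visc)// le_eqVlt; apply/orP; left; apply/eqP; ring.
have f1p := f1gt0 _ p01; have f1pC := f1C _ p01.
have kF : 0 < k * F x0 by rewrite mulr_gt0.
have F''neg : 0 < - F'' x0 by rewrite -(pmulr_rgt0 _ f1p) (lt_le_trans kF).
(* The barrier is concave at [x0], hence [3 (x0 - xc)^2 < r^2], and [F x0] is at
   least [(2/3 r^2)^2]. *)
have X0 : 0 <= (x0 - xc) * (x0 - xc) by rewrite -expr2 sqr_ge0.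
have visc2 : k * F x0 <= C * (4 * r2).
  apply: (le_trans visc); apply: ler_pM; rewrite ?(ltW f1p) ?(ltW F''neg)//.
  by rewrite /F''; clear -X0; lra.
have Fbig : (2 / 3 * r2) * (2 / 3 * r2) <= F x0.
  by rewrite /F; apply: ler_pM; move: F''neg; rewrite /F''; clear -r20; lra.
have : k * ((2 / 3 * r2) * (2 / 3 * r2)) <= C * (4 * r2).
  by rewrite (le_trans _ visc2)// ler_pM2l.
have -> : k * ((2 / 3 * r2) * (2 / 3 * r2)) = 4 / 9 * (k * r2) * r2 by field.
have rr : 0 < r2 * r2 by rewrite mulr_gt0.
by rewrite kr2; clear -rr; lra.
Unshelve. all: by end_near. Qed.

(** * The theorem *)

Unset Implicit Arguments.
Set Strict Implicit.

Theorem theorem2p1 (R : realType) (phi : R -> R)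
    (phi_smooth : smooth phi)
    (phi_even : forall s : R, phi (- s) = phi s)
    (phi_convex : forall s : R, 0 <= s < 1 -> 0 < phi^`(2)%classic s)
    (phi_crit : phi^`(2)%classic 1 = 0)
    (phi_concave : forall s : R, 1 < s -> phi^`(2)%classic s < 0)
    (x1 x2 x3 x4 T : R)
    (x13 : x1 <= x3) (x34 : x3 < x4) (x42 : x4 <= x2) (T_gt0 : 0 < T)
    (u : R * R -> R)
    (u_C1 : C1_cylinder x1 x2 T u)
    (u_sol : solves phi x1 x2 T u)
    (u_init : forall x : R, x3 < x < x4 -> `|partial_x u (x, 0)| < 1) :
  forall x t : R, x3 < x < x4 -> 0 <= t < T -> `|partial_x u (x, t)| < 1.
Proof.
have dphi n (x : R) : is_derive x 1 phi^`(n)%classic (phi^`(n.+1)%classic x).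
  by rewrite derive1nS derive1E; apply/derivableP; exact: phi_smooth.
pose f := phi^`()%classic.
have df (x : R) : is_derive x 1 f (phi^`(2)%classic x) by rewrite /f -derive1n1.
have f1gt0 (s : R) : 0 < s < 1 -> 0 < phi^`(2)%classic s.
  by move=> /andP[s0 s1]; apply: phi_convex; rewrite ltW.
have fmax (s : R) : 0 < s -> f s <= f 1.
  move=> s0; have [s1|s1|->//] := ltgtP s 1.
    by rewrite ltW// (pos_derive_mono df f1gt0)// in_itv/= ?ler01 ?lexx// !ltW.
  have [c /andP[c1 cs] fE] := mean_value s1 (fun z _ => df z).
  have := phi_concave _ c1 => c0.
  by rewrite -subr_le0 fE mulr_le0_ge0 ?subr_ge0 ?ltW.
have fodd (s : R) : f (- s) = - f s.
  by apply: derive1_even => // x; exact: (phi_smooth 0).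
have flow := gradient_flow_C1 u_C1 u_sol.
have persists v p q : gradient_flow f x1 x2 T v p q ->
    (forall x, x3 < x < x4 -> p (x, 0) < 1) ->
    forall x t, x3 < x < x4 -> 0 <= t < T -> p (x, t) < 1.
  move=> vflow vinit.
  exact: (subcritical_persists vflow df (dphi 2) (derive_continuous (dphi 3)) f1gt0 fmax).
move=> x t xx tt; rewrite ltr_norml; apply/andP; split.
  rewrite ltrNl; apply: (persists _ _ _ (gradient_flowN fodd flow)) => // y yy.
  by have := u_init _ yy; rewrite ltr_norml ltrNl => /andP[].
apply: (persists _ _ _ flow) => // y yy.
by have := u_init _ yy; rewrite ltr_norml => /andP[].
Qed.
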